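(* Let $(M,\leq,d)$ be an ordered complete metric space, let $U:M\to M$ be a surjective $\varphi$-expansive mapping, and let $U^*:M\to M$ be a right inverse of $U$ (i.e. $U(U^*x)=x$ for all $x\in M$) such that $U^*$ is $\leq$-increasing. Suppose that there exists $x_0\in M$ such that $x_0\leq U^*x_0$. If $U$ is continuous or $M$ is regular, then $U$ has a fixed point.
   Context: An ordered metric space $(M,\leq,d)$ is a set $M$ with a partial order $\leq$ and a metric $d$; it is an ordered complete metric space if moreover $(M,d)$ is complete. A mapping $U:M\to M$ is called $\varphi$-expansive if there exist a non-decreasing function $\varphi:(0,\infty)\to(1,\infty)$ and a constant $\eta>1$ such that $\varphi(d(Ux,Uz))\geq[\varphi(d(x,z))]^{\eta}$ for all $(x,z)\in M_0$, where $M_0=\{(x,z)\in M\times M : x\leq z,\ d(Ux,Uz)>0\}$. (Note that $d(Ux,Uz)>0$ forces $x\neq z$, so $\varphi(d(x,z))$ is defined.) A mapping $T:M\to M$ is $\leq$-increasing if $x\leq y$ implies $Tx\leq Ty$ for all $x,y\in M$. $M$ is regular if for every increasing sequence $\{x_n\}\subseteq M$ (i.e. $x_n\leq x_{n+1}$ for all $n$) with $x_n\to x^*\in M$, one has $x_n\leq x^*$ for all $n\in\mathbb{N}$. *)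

(* Defs.v *)
From HB Require Import structures.
From mathcomp Require Import all_boot all_order all_algebra.
From mathcomp Require Import all_classical all_reals all_analysis.

Set Implicit Arguments.
Unset Strict Implicit.
Unset Printing Implicit Defensive.

Import Order.TTheory GRing.Theory Num.Theory.

Local Open Scope classical_set_scope.
Local Open Scope ring_scope.

(* No compatibility between the order and the metric is required. *)
#[short(type="orderedMetricType")]
HB.structure Definition OrderedMetric (disp : Order.disp_t) (R : numDomainType) :=
  {M of Metric R M & Order.POrder disp M}.

#[short(type="orderedCompleteMetricType")]
HB.structure Definition OrderedCompleteMetric (disp : Order.disp_t)
    (R : numDomainType) :=
  {M of OrderedMetric disp R M & Complete M}.

Section OrderedMetricDefs.
Context {disp : Order.disp_t} {R : realType} {M : orderedMetricType disp R}.

Definition expansive_pairs (U : M -> M) : set (M * M) :=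
  [set p | (p.1 <= p.2)%O /\ 0 < mdist (U p.1) (U p.2)].

(* A function (0, oo) -> (1, oo) is represented by a total function on R which
   is constrained, and used, on (0, oo) only: distances of pairs in
   [expansive_pairs U] are positive. *)
Definition phi_expansive (U : M -> M) : Prop :=
  exists (phi : R -> R) (eta : R),
    [/\ forall t : R, 0 < t -> 1 < phi t,
        forall s t : R, 0 < s -> s <= t -> phi s <= phi t,
        1 < eta
      & forall x z, expansive_pairs U (x, z) ->
          (phi (mdist x z)) `^ eta <= phi (mdist (U x) (U z))].

End OrderedMetricDefs.

Definition order_regular {disp : Order.disp_t} {R : realType}
    (M : orderedMetricType disp R) : Prop :=
  forall (x : nat -> M) (l : M),
    (forall n, (x n <= x n.+1)%O) -> x @ \oo --> l -> forall n, (x n <= l)%O.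

(* Main.v *)
Require Import Defs.
From mathcomp Require Import all_boot all_order all_algebra.
From mathcomp Require Import all_classical all_reals all_analysis.

(** A right inverse [T] of [U] turns expansion into contraction. For [x <= z]
    with [x != z], applying the expansiveness of [U] to the pair [(T x, T z)]
    and taking logarithms gives [eta * psi (d (T x) (T z)) <= psi (d x z)] for
    [psi := ln \o phi], which is positive and nondecreasing on positive reals
    ([right_inverse_gauge], stated for the iterates of [T]). Since [eta > 1],
    for any scales [a, b] with [a > 0] some iterate of [T] brings every
    comparable pair at distance at most [b] to distance less than [a]: were
    this false, [eta ^ p * psi a <= psi b] would hold for arbitrarily large [p]
    ([near_iter_mdist_lt]).

    The sequence [x_n = T^n x0] is increasing, so its terms are pairwise
    comparable. To see that it is Cauchy ([picard_cauchy]), fix [e > 0], take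
    [p] such that [T^p] shrinks distance [e / 2] below [e / 4], and then a
    starting index [q] such that [x_q, ..., x_(q+p)] lie within [e / 4] of
    [x_q]. By induction the whole tail stays within [e / 2] of [x_q]: applying
    [T^p] to the pair [(x_q, x_(q+n-p))] puts [x_(q+n)] within [e / 4] of
    [x_(q+p)].

    Let [l] be the limit. If [U] is continuous, then [x_n = U x_(n+1)] tends
    both to [l] and to [U l]. If [M] is regular, then [x_n <= l], and as [T]
    does not increase distances of comparable points, [x_(n+1) = T x_n] tends
    to [T l]; hence [T l = l] and [U l = U (T l) = l]. *)

Import Order.TTheory GRing.Theory Num.Theory.
Local Open Scope classical_set_scope.
Local Open Scope ring_scope.

Lemma near_lt_mulXn (R : realType) (e a b : R) : 1 < e -> 0 < a ->
  \forall p \near \oo, b < e ^+ p * a.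
Proof.
move=> e1 a0.
(* By Bernoulli's inequality, the power grows at least linearly in n. *)
have bern n : 1 + n%:R * (e - 1) <= e ^+ n.
  elim: n => [|n IHn]; first by rewrite mul0r addr0 expr0.
  rewrite -natr1 mulrDl mul1r addrA exprSr.
  apply: (@le_trans _ _ (e ^+ n + (e - 1))); first by rewrite lerD2r.
  rewrite -lerBrDl -{2}(mulr1 (e ^+ n)) -mulrBr ler_peMl ?subr_ge0 ?(ltW e1)//.
  by rewrite exprn_ege1// ltW.
near=> p.
have bp : b / a / (e - 1) <= p%:R by near: p; exact: nbhs_infty_ger.
rewrite -ltr_pdivrMr// (lt_le_trans _ (bern p))//.
by rewrite ltr_pwDl// -ler_pdivrMr// subr_gt0.
Unshelve. all: by end_near. Qed.

Section RightInverse.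
Context {disp : Order.disp_t} {R : realType} {M : orderedMetricType disp R}.
Variables (U T : M -> M).
Hypothesis UT : cancel T U.
Hypothesis T_incr : {homo T : x y / (x <= y)%O}.
Hypothesis U_exp : phi_expansive U.

Lemma iter_incr p : {homo iter p T : x y / (x <= y)%O}.
Proof. by move=> x z xz; elim: p => //= p; exact: T_incr. Qed.

(** Logarithms make the exponent [eta] of the expansiveness condition a
    multiplicative factor, so that iterating [T] multiplies these factors.
    Injectivity of [T] keeps the iterates of distinct points at positive
    distance, where the condition on [U] applies. *)
Lemma right_inverse_gauge : exists (psi : R -> R) (eta : R),
  [/\ forall t, 0 < t -> 0 < psi t,
      forall s t, 0 < s -> s <= t -> psi s <= psi t,
      1 < eta
    & forall p x z, (x <= z)%O -> x != z ->
        eta ^+ p * psi (mdist (iter p T x) (iter p T z)) <= psi (mdist x z)].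
Proof.
case: U_exp => phi [eta [phi1 phi_le eta1 phiU]].
have phi0 t : 0 < t -> 0 < phi t by move=> /phi1; exact: lt_trans.
exists (fun t => ln (phi t)), eta; split => //.
- by move=> t /phi1; exact: ln_gt0.
- by move=> s t s0 st; rewrite ler_ln ?posrE ?phi0 ?phi_le// (lt_le_trans s0).
elim=> [|p IHp] x z xz xNz; first by rewrite expr0 mul1r.
apply: le_trans (IHp _ _ xz xNz).
set x' := iter p T x; set z' := iter p T z.
have xz' : (x' <= z')%O by exact: iter_incr.
have xNz' : x' != z'.
  by rewrite (inj_eq (f := iter p T))//; elim: p {IHp x' z' xz'} => //= p IHp;
    exact: inj_comp (can_inj UT) IHp.
have TxNTz' : T x' != T z' by rewrite (inj_eq (can_inj UT)).
rewrite exprSr -mulrA ler_pM2l ?exprn_gt0 ?(lt_trans ltr01)//=.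
rewrite -ln_powR ler_ln ?posrE ?powR_gt0 ?phi0 ?mdist_gt0//.
have := phiU (T x') (T z'); rewrite !UT; apply.
by split; rewrite /= ?UT ?mdist_gt0//; exact: T_incr.
Qed.

(** If [T] increased the distance, monotonicity of the gauge would
    contradict its contraction by the factor [eta > 1]. *)
Lemma right_inverse_le x z : (x <= z)%O -> mdist (T x) (T z) <= mdist x z.
Proof.
move=> xz; have [->|xNz] := eqVneq x z; first by rewrite !mdistxx.
have [psi [eta [psi0 psi_le eta1 /(_ 1%N x z xz xNz)/=]]] := right_inverse_gauge.
rewrite expr1 => psiT; rewrite leNgt; apply/negP => dlt.
have d0 : 0 < mdist x z by rewrite mdist_gt0.
have := le_trans psiT (psi_le _ _ d0 (ltW dlt)).
rewrite -[leRHS]mul1r ler_pM2r ?psi0 ?(lt_trans d0)//.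
by rewrite leNgt eta1.
Qed.

(** The gauge may jump, so it need not control distances quantitatively; but
    a pair whose image stays at distance at least [a] under the [p]-th iterate
    satisfies [eta ^+ p * psi a <= psi b], which bounds [p] independently of
    the pair. *)
Lemma near_iter_mdist_lt (a b : R) : 0 < a ->
  \forall p \near \oo, forall x z, (x <= z)%O -> mdist x z <= b ->
    mdist (iter p T x) (iter p T z) < a.
Proof.
move=> a0.
have [psi [eta [psi0 psi_le eta1 psiT]]] := right_inverse_gauge.
apply: filterS (near_lt_mulXn _ _ _ (psi b) eta1 (psi0 a a0)) => p.
apply: contraPP => /existsNP[x] /existsNP[z].
move=> /not_implyP[xz] /not_implyP[xzb] /negP; rewrite -leNgt => aT.
apply/negP; rewrite -leNgt.
have xNz : x != z.
  by apply: contra_leN aT => /eqP ->; rewrite mdistxx.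
apply: (le_trans _ (psi_le _ _ _ xzb)); last by rewrite mdist_gt0.
apply: le_trans (psiT p _ _ xz xNz).
by rewrite ler_pM2l ?psi_le// exprn_gt0// (lt_trans ltr01).
Qed.

Variable x0 : M.
Hypothesis x0_le : (x0 <= T x0)%O.

Lemma picard_incr n : (iter n T x0 <= iter n.+1 T x0)%O.
Proof. by rewrite iterSr; exact: iter_incr. Qed.

Lemma picard_le m n : (iter m T x0 <= iter (m + n) T x0)%O.
Proof.
by elim: n => [|n IHn]; rewrite ?addn0// addnS (le_trans IHn)// picard_incr.
Qed.

(** Summing the distances of consecutive terms is not possible, as their
    decay has no known rate; instead, a ball around a late term is shown to
    absorb the orbit, [p] steps at a time. *)
Lemma picard_cauchy : cauchy ((fun n => iter n T x0) @ \oo).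
Proof.
apply: cauchy_exP => e e0.
have e2 : 0 < e / 2 by rewrite divr_gt0.
have e4 : 0 < e / 2 / 2 by rewrite divr_gt0.
have [p p0 shrink] : exists2 p, (0 < p)%N &
    forall x z, (x <= z)%O -> mdist x z <= e / 2 ->
      mdist (iter p T x) (iter p T z) < e / 2 / 2.
  have [p _ ph] := near_iter_mdist_lt (e / 2 / 2) (e / 2) e4.
  (* p > 0 makes the induction of all_blocks decrease *)
  by exists p.+1 => //; apply: ph => /=.
(* any bound on the distances from x0 to the first p iterates would do *)
pose b := \sum_(j < p.+1) mdist x0 (iter j T x0).
have [q _ /(_ q (leqnn q)) qb] := near_iter_mdist_lt (e / 2 / 2) b e4.
have first_block j : (j <= p)%N ->
    mdist (iter q T x0) (iter (q + j) T x0) < e / 2 / 2.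
  move=> jp; rewrite iterD; apply: qb; first exact: (picard_le 0 j).
  rewrite /b (bigD1 (Ordinal (jp : (j < p.+1)%N)))//= lerDl.
  by apply: sumr_ge0 => i _; exact: mdist_ge0.
have all_blocks n : mdist (iter q T x0) (iter (q + n) T x0) <= e / 2.
  elim/ltn_ind: n => n IHn; have [np|pn] := leqP n p.
    by rewrite (le_trans (ltW (first_block n np)))// ler_pdivrMr// ler_peMr
      ?ltW// ltr1n.
  rewrite (le_trans (metric_triangle _ (iter (q + p) T x0) _))//.
  rewrite (splitr (e / 2)) lerD ?ltW//; first exact: first_block.
  have -> : (q + n = p + (q + (n - p)))%N by rewrite addnCA subnKC// ltnW.
  rewrite (addnC q p) !(iterD p); apply: shrink; first exact: picard_le.
  by apply: IHn; rewrite ltn_subrL p0 (leq_ltn_trans _ pn).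
exists (iter q T x0), q => // n /= qn.
rewrite ballEmdist/= -(subnKC qn) (le_lt_trans (all_blocks _))//.
by rewrite ltr_pdivrMr// ltr_pMr// ltr1n.
Qed.

End RightInverse.

Theorem theorem2p1 (disp : Order.disp_t) (R : realType)
    (M : orderedCompleteMetricType disp R) (U Ustar : M -> M)
    (U_surj : set_surj [set: M] [set: M] U)
    (U_expansive : phi_expansive U)
    (UstarK : forall x : M, U (Ustar x) = x)
    (Ustar_incr : {homo Ustar : x y / (x <= y)%O})
    (x0_ex : exists x0 : M, (x0 <= Ustar x0)%O)
    (U_cont_or_M_regular : continuous U \/ order_regular M) :
  exists x : M, U x = x.
Proof.
have [x0 x0_le] := x0_ex.
set x := fun n => iter n Ustar x0.
have /cauchy_cvgP/cvg_ex[l xl] : cauchy (x @ \oo).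
  exact: (picard_cauchy U Ustar UstarK Ustar_incr U_expansive x0 x0_le).
have xSl : x n.+1 @[n --> \oo] --> l by rewrite (cvg_shiftS x).
exists l; case: U_cont_or_M_regular => [U_cont|M_reg].
  apply: (cvg_unique _ _ xl); first exact: metric_hausdorff.
  have -> : x = U \o (fun n => x n.+1) by apply/funext => n /=; rewrite UstarK.
  by apply: cvg_comp xSl _; exact: U_cont.
rewrite -[l in U l](_ : Ustar l = l) ?UstarK//.
apply: (cvg_unique _ _ xSl); first exact: metric_hausdorff.
apply/metricType_numDomainType.cvgrPdist_lt => e e0.
have /metricType_numDomainType.cvgrPdist_lt/(_ e e0) := xl.
apply: filterS => n; apply: le_lt_trans.
rewrite metric_sym [leRHS]metric_sym.
apply: (right_inverse_le U Ustar UstarK Ustar_incr U_expansive).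
by apply: M_reg xl n => k; exact: picard_incr.
Qed.
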